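(* Let $p,q\in(0,\infty]$ be such that $\frac1r:=\frac1p+\frac1q>1$, let $\gamma\in\mathbb{R}$, and assume that the estimate $$\|T_\lambda(f,g)\|_1\lesssim\lambda^{-\gamma}\|f\|_p\|g\|_q$$ holds for all $f\in\ell^p(\mathbb{Z}^d)$, $g\in\ell^q(\mathbb{Z}^d)$. Then for each $s\in[r,1]$, $$\|T_\lambda(f,g)\|_s\lesssim\lambda^{\frac{d(1-s)}{2s}-\gamma}\|f\|_p\|g\|_q$$ for all $f\in\ell^p(\mathbb{Z}^d)$, $g\in\ell^q(\mathbb{Z}^d)$, where the implied constant may depend on $s$ and $d$ (and on the implied constant of the assumed estimate) but does not depend on $\lambda$.
   Context: $\|h\|_s=\big(\sum_{x\in\mathbb{Z}^d}|h(x)|^s\big)^{1/s}$ for $0<s<\infty$ (a quasi-norm when $s<1$), and $|\cdot|$ is the Euclidean norm. For a positive integer $\lambda$ the discrete bilinear spherical average on $\mathbb{Z}^d$ is $$T_\lambda(f,g)(x) = \frac{1}{N(\lambda)} \sum_{\substack{u,v\in\mathbb{Z}^d\\ |u|^2+|v|^2=\lambda}} f(x-u)\,g(x-v),\qquad N(\lambda)=\#\{(u,v)\in\mathbb{Z}^d\times\mathbb{Z}^d:|u|^2+|v|^2=\lambda\}$$ (for $\lambda$ with $N(\lambda)>0$). $X\lesssim Y$ means $X\le CY$ with $C$ independent of $\lambda$, $f$ and $g$. *)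

(* Defs.v *)
From mathcomp Require Import all_boot all_order all_algebra finmap complex.
From mathcomp Require Import all_classical all_reals all_analysis.

Set Implicit Arguments.
Unset Strict Implicit.
Unset Printing Implicit Defensive.

Import Order.TTheory GRing.Theory Num.Theory.

Local Open Scope classical_set_scope.
Local Open Scope ring_scope.

Local Notation normc := ComplexField.Normc.normc.

(* |u|^2 for the Euclidean norm. *)
Definition sqnorm (d : nat) (u : 'rV[int]_d) : int := \sum_(i < d) u 0 i ^+ 2.

Definition bisphere (d l : nat) : set ('rV[int]_d * 'rV[int]_d) :=
  [set w | sqnorm w.1 + sqnorm w.2 = l%:Z].
Arguments bisphere : clear implicits.

Lemma finite_bisphere (d l : nat) : finite_set (bisphere d l).
Proof.
pose F (h : {ffun 'I_d -> 'I_(l.*2.+1)}) : 'rV[int]_d :=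
  \row_i ((h i)%:Z - l%:Z).
apply: (@sub_finite_set _ _
  ((fun h : {ffun 'I_d -> 'I_(l.*2.+1)} * {ffun 'I_d -> 'I_(l.*2.+1)} =>
    (F h.1, F h.2)) @` setT)); last first.
  by apply: finite_image; exact: finite_finset.
have sq_ge0 (u : 'rV[int]_d) : 0 <= sqnorm u.
  by apply: sumr_ge0 => i _; exact: sqr_ge0.
have repr (u : 'rV[int]_d) : sqnorm u <= l%:Z -> exists h, F h = u.
  move=> ul; exists [ffun i : 'I_d => inord (absz (u 0 i + l%:Z))].
  apply/rowP => i; rewrite !mxE ffunE.
  have u2 : u 0 i ^+ 2 <= l%:Z.
    apply: le_trans ul; rewrite /sqnorm (bigD1 i)//= lerDl.
    by apply: sumr_ge0 => j _; exact: sqr_ge0.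
  have [u1 u3] : - l%:Z <= u 0 i /\ u 0 i <= l%:Z.
    have : `|u 0 i| <= l%:Z.
      apply: le_trans u2; rewrite -[_ ^+ 2]ger0_norm ?sqr_ge0// normrX.
      have [->|] := eqVneq (u 0 i) 0; first by rewrite normr0 expr0n.
      rewrite -normr_gt0 => u0.
      by rewrite expr2 ler_peMr// -gtz0_ge1.
    by rewrite ler_norml => /andP.
  have ul0 : 0 <= u 0 i + l%:Z by rewrite -lerBlDr sub0r.
  rewrite inordK; first by rewrite gez0_abs// addrK.
  rewrite ltnS -lez_nat gez0_abs// -addnn PoszD lerD2r //.
move=> [u v]; rewrite /bisphere/= => uvl.
have [h1 h1E] : exists h, F h = u by apply: repr; rewrite -uvl lerDl.
have [h2 h2E] : exists h, F h = v by apply: repr; rewrite -uvl lerDr.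
by exists (h1, h2) => //=; rewrite h1E h2E.
Qed.

(* fset_set is the empty set by default on infinite sets, and sums over infinite
   supports are 0 by default; finite_bisphere rules both out. *)
Definition bisphere_card (d l : nat) : nat := #|` fset_set (bisphere d l)|.

Definition bisphere_avg (R : realType) (d l : nat) (f g : 'rV[int]_d -> R[i])
    (x : 'rV[int]_d) : R[i] :=
  (bisphere_card d l)%:R^-1 *
  \sum_(w \in bisphere d l) (f (x - w.1) * g (x - w.2)).

(* Only meaningful for an exponent p in (0, +oo]; h is in l^p(Z^d) iff
   lpnorm p h < +oo. *)
Definition lpnorm (R : realType) (d : nat) (p : \bar R) (h : 'rV[int]_d -> R[i])
    : \bar R :=
  match p with
  | s%:E => poweR (\esum_(x in [set: 'rV[int]_d])
                     ((normc (h x)) `^ s)%:E) s^-1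
  | _ => ereal_sup [set (normc (h x))%:E | x in [set: 'rV[int]_d]]
  end.

(* Main.v *)
Require Import Defs.
From mathcomp Require Import all_boot all_order all_algebra finmap complex.
From mathcomp Require Import all_classical all_reals all_analysis.
From mathcomp Require Import ring lra zify.

(** The pairs [(u, v)] of the average satisfy [|u|, |v| <= sqrt l], so the
    operator is local at scale [sqrt l]: its value at [x] only sees [f] and [g]
    near [x].  On a cube of side about [sqrt l], which has about [l ^ (d / 2)]
    points, Hoelder's inequality bounds the l^s quasi-norm by
    [l ^ (d (1 - s) / (2 s))] times the l^1 norm, and this factor is exactly
    the loss in the conclusion.  It remains to add up over the cubes.

    Tile Z^d by cubes of side [m], with [sqrt l <= m <= 2 sqrt l], and cut [f]
    and [g] into their restrictions to the cubes ([piece]).  On the cube [j],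
    [bisphere_avg l f g] is the sum, over the [9 ^ d] pairs of cubes [(k, k')]
    adjacent or equal to [j], of the averages of the pieces [f_k] and [g_k']
    ([bisphere_avg_pieces]).  As [s <= 1], the [s]-th power of a sum is at most
    the sum of the [s]-th powers ([powR_sum_le]), so each pair of offsets can be
    treated separately.  For a fixed pair, Hoelder on the cube
    ([esum_powR_le_card]) and the assumed l^1 estimate applied to the two pieces
    leave the sum over [j] of the [(|f_k|_p |g_k'|_q) ^ s].

    For that sum, write [|f_k|_p <= |f|_p W_k ^ (1 / p)] and
    [|g_k'|_q <= |g|_q V_k' ^ (1 / q)] where [W] and [V] have total mass at most
    1 ([lpnorm_piece]).  Since [1 / p + 1 / q = 1 / r >= 1 / s], one has
    [(W ^ (1 / p) V ^ (1 / q)) ^ s <= max W V <= W + V] ([powR_mul_le_add]),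
    and the sum over all cubes is at most 2.

    It matters that the input functions are cut into single cubes: pieces on
    neighbourhoods of cubes could cost a factor of order [3 ^ (d / r)], whereas
    the constant obtained here depends on [s] and [d] only. *)

Set Implicit Arguments.
Unset Strict Implicit.
Unset Printing Implicit Defensive.

Import Order.TTheory GRing.Theory Num.Theory.

Local Open Scope classical_set_scope.
Local Open Scope ring_scope.

Local Notation normc := ComplexField.Normc.normc.

(** * Powers with exponent at most one *)

Section powR.
Context {R : realType}.
Implicit Types s t x y : R.

(** The fractions [x / (x + y)] and [y / (x + y)] lie in [0, 1] and add up to
    1; raising them to a power at most 1 can only increase them. *)
Lemma powR_subadd s x y : 0 < s <= 1 -> 0 <= x -> 0 <= y ->
  (x + y) `^ s <= x `^ s + y `^ s.
Proof.
move=> /andP[s0 s1] x0 y0.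
have [xy0|xyn0] := eqVneq (x + y) 0.
  by rewrite xy0 powR0 ?gt_eqF// addr_ge0 ?powR_ge0.
have xy_gt0 : 0 < x + y by rewrite lt0r xyn0 addr_ge0.
have frac z : 0 <= z <= x + y -> z / (x + y) <= (z / (x + y)) `^ s.
  move=> /andP[z0 zxy]; have [->|zn0] := eqVneq z 0.
    by rewrite mul0r powR_ge0.
  have zp : 0 < z by rewrite lt0r zn0.
  rewrite ger1_powR// divr_gt0//=.
  by rewrite ler_pdivrMr ?mul1r.
have -> : x `^ s + y `^ s =
    ((x / (x + y)) `^ s + (y / (x + y)) `^ s) * (x + y) `^ s.
  by rewrite mulrDl -!powRM ?divr_ge0 ?addr_ge0// !divfK.
rewrite ler_peMl ?powR_ge0// (le_trans _ (lerD (frac x _) (frac y _)))//.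
- by rewrite -mulrDl divff.
- by rewrite x0 lerDl.
- by rewrite y0 lerDr.
Qed.

Lemma powR_sum_le (I : Type) (r : seq I) (P : pred I) (a : I -> R) s :
  0 < s <= 1 -> (forall i, 0 <= a i) ->
  (\sum_(i <- r | P i) a i) `^ s <= \sum_(i <- r | P i) a i `^ s.
Proof.
move=> s01 a0; have [s0 _] := andP s01.
pose Q (u v : R) := 0 <= u /\ u `^ s <= v.
suff [] : Q (\sum_(i <- r | P i) a i) (\sum_(i <- r | P i) a i `^ s) by [].
apply: (big_ind2 Q) => [|u1 v1 u2 v2 [u1p uv1] [u2p uv2]|i _]; rewrite /Q.
- by rewrite powR0 ?gt_eqF.
- split; first exact: addr_ge0.
  by rewrite (le_trans (powR_subadd _ _ _))// lerD.
- by [].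
Qed.

(** Young's inequality with conjugate exponents [1 / s] and [1 / (1 - s)],
    extended to [s = 1]. *)
Lemma powR_young s x y : 0 < s <= 1 -> 0 <= x -> 0 <= y ->
  x `^ s * y `^ (1 - s) <= s * x + (1 - s) * y.
Proof.
move=> /andP[s0 s1] x0 y0; have [->|sn1] := eqVneq s 1.
  by rewrite subrr powRr0 mul0r addr0 mulr1 mul1r powRr1.
have s1' : 0 < 1 - s by rewrite subr_gt0 lt_neqAle sn1.
have := @conjugate_powR _ (x `^ s) (y `^ (1 - s)) s^-1 (1 - s)^-1
  (powR_ge0 _ _) (powR_ge0 _ _).
rewrite !invr_gt0 !invrK => /(_ s0 s1') /(_ ltac:(by rewrite addrC subrK)).
by rewrite -!powRrM !mulfV ?gt_eqF// !powRr1// ![_ * s]mulrC [y * _]mulrC.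
Qed.

(** Hoelder's inequality against the constant 1.  It follows by adding up the
    bounds given by [powR_young] with [y] the mean value [S / N]. *)
Lemma sum_powR_le_card (T : choiceType) (Y : {fset T}) (t : T -> R) (N s S : R) :
  0 < s <= 1 -> (forall i, 0 <= t i) -> #|` Y|%:R <= N ->
  \sum_(i <- Y) t i <= S ->
  \sum_(i <- Y) t i `^ s <= N `^ (1 - s) * S `^ s.
Proof.
move=> s01 t0 YN tS; have [s0 s1] := andP s01.
have sumt0 : 0 <= \sum_(i <- Y) t i by apply: sumr_ge0.
have S0 : 0 <= S by exact: le_trans tS.
have N0 : 0 <= N by exact: le_trans YN.
(* The mean value argument needs [S / N > 0]. *)
have [SE|Sn0] := eqVneq S 0.
  have /eqP : \sum_(i <- Y) t i = 0
    by apply/le_anti; rewrite sumt0 andbT -[leRHS]SE.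
  rewrite psumr_eq0// => /allP tE; rewrite big1_seq ?mulr_ge0 ?powR_ge0//.
  by move=> i /andP[_ /tE/eqP ->]; rewrite powR0// gt_eqF.
have [NE|Nn0] := eqVneq N 0.
  move: YN; rewrite NE lern0 => /eqP/cardfs0_eq ->.
  by rewrite big_seq_fset0 mulr_ge0 ?powR_ge0.
have Npos : 0 < N by rewrite lt0r Nn0.
have Spos : 0 < S by rewrite lt0r Sn0.
have Mpos : 0 < S / N by rewrite divr_gt0.
rewrite -(ler_pM2r (powR_gt0 (1 - s) Mpos)) mulr_suml.
have -> : N `^ (1 - s) * S `^ s * (S / N) `^ (1 - s) = S.
  transitivity ((N * N^-1) `^ (1 - s) * (S `^ s * S `^ (1 - s))).
    by rewrite !powRM ?invr_ge0//; ring.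
  rewrite divff// powR1 mul1r -powRD ?Sn0 ?implybT//.
  by rewrite subrKC powRr1.
apply: (@le_trans _ _ (\sum_(i <- Y) (s * t i + (1 - s) * (S / N)))).
  by apply: ler_sum => i _; rewrite powR_young// ltW.
rewrite big_split/= -mulr_sumr big_const_seq count_predT iter_addr_0.
rewrite [leRHS](_ : S = s * S + (1 - s) * S); last by ring.
rewrite lerD ?ler_pM2l// -mulrnAr ler_wpM2l ?subr_ge0//.
by rewrite -[leRHS](divfK Nn0) -mulr_natr ler_wpM2l// ltW.
Qed.
End powR.

(** * Sums over arbitrary index sets *)

Section esum.
Context {R : realType}.
Local Open Scope ereal_scope.

Lemma esum_fibers (T J : choiceType) (b : T -> J) (a : T -> \bar R) :
  (forall x, 0 <= a x) ->
  \esum_(x in [set: T]) a x =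
  \esum_(j in [set: J]) \esum_(x in b @^-1` [set j]) a x.
Proof.
move=> a0; rewrite esum_esum//.
rewrite (reindex_esum [set: T] _ (fun x => (b x, x)))//; split.
- by move=> x _ /=.
- by move=> x y _ _ /= [].
- by move=> [j x] [_ /= <-]; exists x.
Qed.

Lemma ge0_esumZl (T : choiceType) (A : set T) (a : T -> \bar R) (c : R) :
  (0 <= c)%R -> (forall x, 0 <= a x) ->
  \esum_(x in A) (c%:E * a x) = c%:E * \esum_(x in A) a x.
Proof.
move=> c0 a0; rewrite /esum -ereal_supZl//; last first.
  by apply/set0P; eexists; exists set0; [exact: fsets_set0|reflexivity].
by rewrite image_comp; congr ereal_sup; apply: eq_imagel => X [finX _] /=;
  rewrite ge0_mule_fsumr.
Qed.

Lemma esum_term_le (T : choiceType) (A : set T) (a : T -> \bar R) x :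
  A x -> a x <= \esum_(y in A) a y.
Proof.
move=> Ax; apply: esum_ge; exists [set x]; last by rewrite fsbig_set1.
by split; [exact: finite_set1|rewrite sub1set inE].
Qed.

End esum.

(** * Cutting a function into pieces *)

Section lpnorm.
Context {R : realType} {d : nat} {J : choiceType}.
Variable b : 'rV[int]_d -> J.
Implicit Types (h : 'rV[int]_d -> R[i]) (p : \bar R).

Definition piece h j x : R[i] := if b x == j then h x else 0.

Lemma normc_ge0 (z : R[i]) : 0 <= normc z.
Proof. by case: z => x y; exact: sqrtr_ge0. Qed.

Lemma normc_sum (I : Type) (r : seq I) (P : pred I) (z : I -> R[i]) :
  normc (\sum_(i <- r | P i) z i) <= \sum_(i <- r | P i) normc (z i).
Proof.
elim/big_ind2 : _ => [|u1 v1 u2 v2 uv1 uv2|//].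
  by rewrite ComplexField.Normc.normc0.
by rewrite (le_trans (le_normcD _ _))// lerD.
Qed.

Lemma lpnorm_ge0 p h : (0 <= lpnorm p h)%E.
Proof.
case: p => [s| |] /=; first exact: poweR_ge0.
  by apply: ereal_sup_ge; exists (normc (h 0))%:E;
    [exists 0|rewrite lee_fin normc_ge0].
by apply: ereal_sup_ge; exists (normc (h 0))%:E;
  [exists 0|rewrite lee_fin normc_ge0].
Qed.

Lemma lpnorm_piece_esum h (s : R) j : 0 < s ->
  lpnorm s%:E (piece h j) =
  ((\esum_(x in b @^-1` [set j]) (normc (h x) `^ s)%:E) `^ s^-1)%E.
Proof.
move=> s0 /=; congr (_ `^ _)%E; rewrite [RHS]esum_mkcond.
apply: eq_esum => x _; rewrite /piece; case: ifPn => [/eqP bx|/eqP bx].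
  by rewrite ifT//; apply/mem_set.
rewrite ifF; last by apply/negbTE; rewrite notin_setE.
by rewrite ComplexField.Normc.normc0 powR0// gt_eqF.
Qed.

(** The weight [W j] is the share of the fibre [j] in the sum of the
    [|h x| ^ p].  For [p = +oo] the exponent [fine p^-1] is 0, so that
    [W j `^ fine p^-1 = 1] whatever the weight: the case [p = +oo] then needs
    no separate treatment later. *)
Lemma lpnorm_piece p h : (0 < p)%E -> (lpnorm p h < +oo)%E ->
  exists W : J -> R,
    [/\ forall j, 0 <= W j,
        (\esum_(j in [set: J]) (W j)%:E <= 1)%E &
        forall j, (lpnorm p (piece h j) <=
          lpnorm p h * (W j `^ fine p^-1)%:E)%E].
Proof.
case: p => [s|_ _|//].
  rewrite lte_fin => s0 hfin.
  have a0 x : (0 <= (normc (h x) `^ s)%:E)%E by rewrite lee_fin powR_ge0.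
  pose S := \esum_(x in [set: 'rV[int]_d]) (normc (h x) `^ s)%:E.
  pose Sj j := \esum_(x in b @^-1` [set j]) (normc (h x) `^ s)%:E.
  have Sj0 j : (0 <= Sj j)%E by apply: esum_ge0.
  have SE : S = \esum_(j in [set: J]) Sj j by exact: esum_fibers.
  have Sfin : S \is a fin_num.
    rewrite ge0_fin_numE ?esum_ge0//; apply: lty_poweRy hfin.
    by rewrite invr_neq0// gt_eqF.
  have SjS j : (Sj j <= S)%E by rewrite SE; exact: esum_term_le.
  have Sjfin j : Sj j \is a fin_num.
    by rewrite ge0_fin_numE// (le_lt_trans (SjS j))// ltey_eq Sfin.
  have fS0 : 0 <= fine S by rewrite fine_ge0// esum_ge0.
  (* If the total [S] vanishes, so does every [Sj j], and [_ / 0 = 0]. *)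
  have WE j : fine (Sj j) = fine S * (fine (Sj j) / fine S).
    have [S0|Sn0] := eqVneq (fine S) 0; last by rewrite mulrC divfK.
    rewrite S0 mul0r; apply/le_anti; rewrite fine_ge0// andbT -S0.
    exact: fine_le.
  exists (fun j => fine (Sj j) / fine S); split => [j||j].
  - by rewrite divr_ge0// fine_ge0.
  - under eq_esum do rewrite mulrC EFinM fineK//.
    rewrite ge0_esumZl ?invr_ge0// -SE -[S in leLHS]fineK// -EFinM lee_fin.
    by have [->|?] := eqVneq (fine S) 0; rewrite ?mulr0// mulVf.
  - rewrite lpnorm_piece_esum//= -/(Sj j) -/S -[Sj j]fineK// -[S in leRHS]fineK//.
    rewrite {1}WE inver gt_eqF//= -EFinM lee_fin.
    by rewrite powRM// divr_ge0// fine_ge0.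
exists (fun=> 0); split => [//||j].
  by rewrite esum1// lee01.
rewrite invey/= powRr0 mule1; apply: ge_ereal_sup => _ /= [x _ <-].
rewrite /piece; case: ifP => _; last first.
  by rewrite ComplexField.Normc.normc0 (lpnorm_ge0 +oo%E).
by apply: ereal_sup_ubound; exists x.
Qed.

Lemma lpnorm_piece_fin p h j : (0 < p)%E -> (lpnorm p h < +oo)%E ->
  (lpnorm p (piece h j) < +oo)%E.
Proof.
move=> p0 hfin; have [W [_ _ /(_ j)]] := lpnorm_piece p0 hfin.
move=> /le_lt_trans; apply; rewrite lte_mul_pinfty ?lpnorm_ge0//.
  by rewrite ge0_fin_numE ?lpnorm_ge0.
by rewrite ltry.
Qed.
End lpnorm.

(** * Cubes and the locality of the average *)

Section cubes.
Context {d : nat} (m : nat).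
Hypothesis m0 : (0 < m)%N.
Implicit Types x u : 'rV[int]_d.

Definition cube_of x : 'rV[int]_d := \row_i (x 0%R i %/ m)%Z.

(** The vectors with coordinates in {-1, 0, 1}, indexed by a finite type so that
    they can be summed over. *)
Definition cube_offset (e : {ffun 'I_d -> 'I_3}) : 'rV[int]_d :=
  \row_i ((e i)%:Z - 1).

Lemma cube_offset_inj : injective cube_offset.
Proof.
move=> e e' /rowP ee'; apply/ffunP => i; apply/val_inj.
by have := ee' i; rewrite !mxE => /addIr[].
Qed.

Lemma cube_of_near x u : (forall i, `|u 0 i| <= m%:Z) ->
  exists e, cube_of (x - u) = cube_of x + cube_offset e.
Proof.
move=> um; exists [ffun i => inord (absz ((cube_of (x - u) - cube_of x) 0 i + 1))].
apply/rowP => i; rewrite !mxE ffunE.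
have -> : (cube_of (x - u) - cube_of x) 0 i =
    ((x 0%R i - u 0%R i) %/ m)%Z - (x 0%R i %/ m)%Z by rewrite !mxE.
have := um i; move: (u 0 i) (x 0 i) => a c;
  rewrite ler_norml => /andP[am1 am2].
have dm y := divz_eq y m; have rm y := ltz_pmod y (m0 : 0 < m%:Z).
have rp y : 0 <= (y %% m)%Z by apply: modz_ge0; rewrite gt_eqF.
have := (dm c, dm (c - a), rm c, rm (c - a), rp c, rp (c - a)).
move: (c %/ m)%Z ((c - a) %/ m)%Z (c %% m)%Z ((c - a) %% m)%Z => q q' r r'.
move=> [[[[[cE caE] rm1] rm2] rp1] rp2].
have [h1 h2] : q' - q >= - 1 /\ q' - q <= 1 by split; nia.
by rewrite inordK; lia.
Qed.

(** A point of a cube is determined by the residues of its coordinates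
    modulo [m]. *)
Lemma card_cube_le (Y : {fset 'rV[int]_d}) (j : 'rV[int]_d) :
  (forall x, x \in Y -> cube_of x = j) -> (#|` Y| <= m ^ d)%N.
Proof.
move=> Yj.
pose res x : {ffun 'I_d -> 'I_m.-1.+1} := [ffun i => inord (absz (x 0%R i %% m)%Z)].
have res_inj : {in Y &, injective res}.
  move=> x y xY yY /ffunP xy; apply/rowP => i.
  have /rowP/(_ i) : cube_of x = cube_of y by rewrite !Yj.
  have /(congr1 val) := xy i; rewrite !mxE !ffunE /=.
  have rm z := ltz_pmod z (m0 : 0 < m%:Z).
  have rp z : 0 <= (z %% m)%Z by apply: modz_ge0; rewrite gt_eqF.
  have := (rm (x 0 i), rm (y 0 i), rp (x 0 i), rp (y 0 i)).
  move=> [[[rmx rmy] rpx] rpy].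
  rewrite !inordK; [|lia|lia] => r_eq q_eq.
  by rewrite (divz_eq (x 0 i) m) (divz_eq (y 0 i) m) q_eq; lia.
have ures : uniq (map res Y) by rewrite map_inj_in_uniq// fset_uniq.
have := card_uniqP ures; rewrite size_map => <-.
by rewrite (leq_trans (max_card _))// card_ffun !card_ord prednK.
Qed.

Lemma bisphere_coord (l : nat) w i : (l <= m ^ 2)%N -> bisphere d l w ->
  `|w.1 0 i| <= m%:Z /\ `|w.2 0 i| <= m%:Z.
Proof.
move=> lm wl.
have sq_le (u : 'rV[int]_d) : u 0 i ^+ 2 <= sqnorm u.
  by rewrite /sqnorm (bigD1 i)//= lerDl sumr_ge0// => k _; exact: sqr_ge0.
have := (sq_le w.1, sq_le w.2, wl : sqnorm w.1 + sqnorm w.2 = l%:Z).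
have := (sqr_ge0 (w.1 0 i), sqr_ge0 (w.2 0 i)).
move: (w.1 0 i) (w.2 0 i) (sqnorm w.1) (sqnorm w.2) => a b A B.
by move=> [a0 b0] [[aA bB] AB]; split; nia.
Qed.

Context {R : realType}.
Implicit Types f g : 'rV[int]_d -> R[i].

Lemma sum_pieces f x u : (forall i, `|u 0 i| <= m%:Z) ->
  \sum_e piece cube_of f (cube_of x + cube_offset e) (x - u) = f (x - u).
Proof.
move=> /(cube_of_near x)[e xue]; rewrite (bigD1 e)//= /piece xue eqxx.
rewrite big1 ?addr0// => e' e'e; rewrite ifF//; apply/negbTE.
by rewrite (inj_eq (addrI _)) (inj_eq cube_offset_inj) eq_sym.
Qed.

(** The pieces depend on the point [x] only through its cube, so that on each
    cube this is an identity between finitely many fixed averages. *)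
Lemma bisphere_avg_pieces (l : nat) f g x : (l <= m ^ 2)%N ->
  bisphere_avg l f g x =
  \sum_e bisphere_avg l (piece cube_of f (cube_of x + cube_offset e.1))
                        (piece cube_of g (cube_of x + cube_offset e.2)) x.
Proof.
move=> lm; rewrite /bisphere_avg -mulr_sumr; congr (_ * _).
have fin := finite_bisphere d l.
under [RHS]eq_bigr => e _ do rewrite (fsbig_finite _ _ fin).
rewrite (fsbig_finite _ _ fin) exchange_big/=.
apply: eq_big_seq => w; rewrite in_fset_set ?finite_bisphere// inE => wl.
rewrite -{1}(sum_pieces f x (fun i => (bisphere_coord i lm wl).1)).
rewrite -{1}(sum_pieces g x (fun i => (bisphere_coord i lm wl).2)).
by rewrite big_distrlr/= pair_big.
Qed.

End cubes.

(** * Summation over the cubes *)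

Section bounds.
Context {R : realType}.
Implicit Types s t u x y : R.

Lemma esum_powR_le_card (T : choiceType) (Y : set T) (a : T -> R) N s S :
  0 < s <= 1 -> (forall i, 0 <= a i) ->
  (forall X : {fset T}, [set` X] `<=` Y -> #|` X|%:R <= N) ->
  (\esum_(i in Y) (a i)%:E <= S%:E)%E ->
  (\esum_(i in Y) (a i `^ s)%:E <= (N `^ (1 - s) * S `^ s)%:E)%E.
Proof.
move=> s01 a0 YN aS; apply: ge_ereal_sup => _ [X [finX XY] <-].
rewrite fsbig_finite// sumEFin lee_fin.
apply: sum_powR_le_card => //; first by apply: YN; rewrite fset_setK.
rewrite -lee_fin -sumEFin -fsbig_finite//; apply: le_trans aS.
by apply: esum_ge; exists X.
Qed.

(** With [M := max x y], the left-hand side is at most [M `^ ((t + u) * s)],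
    hence at most [M], because [M <= 1] and the exponent is at least 1. *)
Lemma powR_mul_le_add s t u x y : 0 <= t -> 0 <= u -> 0 < s -> 1 <= (t + u) * s ->
  0 <= x <= 1 -> 0 <= y <= 1 -> (x `^ t * y `^ u) `^ s <= x + y.
Proof.
move=> t0 u0 s0 tus /andP[x0 x1] /andP[y0 y1].
pose M := Num.max x y.
have xM : x <= M by rewrite le_max lexx.
have yM : y <= M by rewrite le_max lexx orbT.
have M0 : 0 <= M by exact: le_trans xM.
have Mxy : M <= x + y by rewrite ge_max lerDl lerDr y0 x0.
(* [t + u != 0] makes the law of exponents valid even at [M = 0]. *)
have tu0 : t + u != 0 by apply: contraTneq tus => ->; rewrite mul0r ler10.
apply: le_trans Mxy; apply: (@le_trans _ _ ((M `^ t * M `^ u) `^ s)).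
  by rewrite ge0_ler_powR ?nnegrE ?mulr_ge0 ?powR_ge0 ?(ltW s0)// ler_pM ?powR_ge0//
     ge0_ler_powR ?nnegrE.
rewrite -powRD ?(negPf tu0)// -powRrM.
have [->|Mn0] := eqVneq M 0.
  by rewrite powR0// mulf_neq0// gt_eqF.
by rewrite ge1r_powR// lt0r Mn0 M0 ge_max x1.
Qed.

(** The cubes must be at least as wide as the shifts, and yet have no more than
    a multiple of [l `^ (d / 2)] points. *)
Lemma sqrt_side (l : nat) : (0 < l)%N ->
  exists m : nat, [/\ (0 < m)%N, (l <= m ^ 2)%N & m%:R <= 2 * Num.sqrt l%:R :> R].
Proof.
move=> l0; pose q : R := Num.sqrt l%:R.
have q1 : 1 <= q by rewrite -sqrtr1 ler_sqrt ?ler1n.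
have q0 : 0 <= q by exact: le_trans q1.
have /andP[nq qn] := truncn_itv q0.
exists (Num.truncn q).+1; split => //.
  rewrite -(ler_nat R) natrX -[leLHS](@sqr_sqrtr R) ?ler0n//.
  by rewrite ler_pXn2r ?nnegrE// ltW.
by rewrite -natr1 -/q; lra.
Qed.

Lemma fine_inv_ge0 (r : \bar R) : (0 < r)%E -> 0 <= fine r^-1.
Proof. by move=> r0; apply: fine_ge0; rewrite inve_ge0 ltW. Qed.

Lemma lpnorm1E d (h : 'rV[int]_d -> R[i]) :
  lpnorm 1%:E h = \esum_(x in [set: 'rV[int]_d]) (normc (h x))%:E.
Proof.
rewrite /= invr1 poweRe1; last by apply: esum_ge0 => x _; rewrite lee_fin powR_ge0.
by apply: eq_esum => x _; rewrite powRr1// normc_ge0.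
Qed.

End bounds.

(** Only the l^1 estimate at the given [l] is used, so its constant, including
    the power of [l], is a single number [D].  The hypothesis [pqs] is
    [1 / s <= 1 / p + 1 / q], written with [fine p^-1] and [fine q^-1] because
    these vanish for infinite exponents. *)
Section pair.
Context {R : realType} {d : nat}.
Variables (p q : \bar R) (l m : nat) (D N s : R).
Hypotheses (p0 : (0 < p)%E) (q0 : (0 < q)%E) (m0 : (0 < m)%N) (D0 : 0 <= D).
Hypotheses (s01 : 0 < s <= 1) (mN : (m ^ d)%:R <= N).
Hypothesis pqs : 1 <= (fine p^-1 + fine q^-1) * s.
Hypothesis l1_bound : forall f g : 'rV[int]_d -> R[i],
  (lpnorm p f < +oo)%E -> (lpnorm q g < +oo)%E ->
  (lpnorm 1%:E (bisphere_avg l f g) <= D%:E * lpnorm p f * lpnorm q g)%E.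

(** The contribution of one pair of offsets: on each cube, Hoelder's inequality
    and the l^1 estimate for the two pieces; then the weights of
    [lpnorm_piece] add up to at most 2 over all cubes. *)
Lemma esum_avg_pieces (f g : 'rV[int]_d -> R[i]) (o1 o2 : 'rV[int]_d) :
  (lpnorm p f < +oo)%E -> (lpnorm q g < +oo)%E ->
  (\esum_(x in [set: 'rV[int]_d])
     (normc (bisphere_avg l (piece (cube_of m) f (cube_of m x + o1))
                            (piece (cube_of m) g (cube_of m x + o2)) x) `^ s)%:E
   <= (N `^ (1 - s) * (D * fine (lpnorm p f) * fine (lpnorm q g)) `^ s * 2)%:E)%E.
Proof.
move=> ffin gfin; have [s0 s1] := andP s01.
have [W [W0 W1 fW]] := lpnorm_piece (cube_of m) p0 ffin.
have [V [V0 V1 gV]] := lpnorm_piece (cube_of m) q0 gfin.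
pose A := fine (lpnorm p f); pose B := fine (lpnorm q g).
have fE : lpnorm p f = A%:E by rewrite fineK// ge0_fin_numE ?lpnorm_ge0.
have gE : lpnorm q g = B%:E by rewrite fineK// ge0_fin_numE ?lpnorm_ge0.
have A0 : 0 <= A by rewrite fine_ge0// lpnorm_ge0.
have B0 : 0 <= B by rewrite fine_ge0// lpnorm_ge0.
have le1 (U : 'rV[int]_d -> R) j : (forall j, 0 <= U j) ->
    (\esum_(j in [set: 'rV[int]_d]) (U j)%:E <= 1)%E -> 0 <= U j <= 1.
  move=> U0 U1; rewrite U0 -lee_fin/=; apply: le_trans U1.
  exact: (@esum_term_le _ _ _ (fun j => (U j)%:E)).
have shift (U : 'rV[int]_d -> R) o :
    (\esum_(j in [set: 'rV[int]_d]) (U j)%:E =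
     \esum_(j in [set: 'rV[int]_d]) (U (j + o))%:E)%E.
  rewrite (reindex_esum [set: _] _ (fun j => j + o))//; split => //.
    by move=> j k _ _ /addIr.
  by move=> j _; exists (j - o) => //; rewrite subrK.
rewrite (esum_fibers (cube_of m)); last by move=> x; rewrite lee_fin powR_ge0.
pose c := N `^ (1 - s) * (D * A * B) `^ s.
have c0 : 0 <= c by rewrite mulr_ge0 ?powR_ge0.
apply: (@le_trans _ _ (\esum_(j in [set: 'rV[int]_d])
    (c%:E * ((W (j + o1))%:E + (V (j + o2))%:E))%E)).
  apply: le_esum => j _.
  pose h := bisphere_avg l (piece (cube_of m) f (j + o1))
                           (piece (cube_of m) g (j + o2)).
  pose w := W (j + o1) `^ fine p^-1 * V (j + o2) `^ fine q^-1.
  have w0 : 0 <= w by rewrite mulr_ge0 ?powR_ge0.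
  have hS : (\esum_(x in cube_of m @^-1` [set j]) (normc (h x))%:E <=
             (D * A * B * w)%:E)%E.
    apply: (@le_trans _ _ (lpnorm 1%:E h)).
      rewrite lpnorm1E esum_mkcond; apply: le_esum => x _.
      by case: ifP => _ //; rewrite lee_fin normc_ge0.
    apply: le_trans (l1_bound (lpnorm_piece_fin _ _ p0 ffin)
                              (lpnorm_piece_fin _ _ q0 gfin)) _.
    have -> : ((D * A * B * w)%:E = D%:E *
        (A%:E * (W (j + o1) `^ fine p^-1)%:E) *
        (B%:E * (V (j + o2) `^ fine q^-1)%:E))%E.
      by rewrite -!EFinM; congr EFin; rewrite /w; ring.
    rewrite lee_pmul ?mule_ge0 ?lpnorm_ge0//.
      by rewrite lee_pmul ?lpnorm_ge0// -fE.
    by rewrite -gE.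
  have card_cube (X : {fset 'rV[int]_d}) :
      [set` X] `<=` cube_of m @^-1` [set j] -> #|` X|%:R <= N.
    move=> Xj; apply: le_trans mN; rewrite ler_nat.
    by apply: (card_cube_le m0 (j := j)) => x /Xj.
  apply: (@le_trans _ _ (N `^ (1 - s) * (D * A * B * w) `^ s)%:E).
    (* On the fibre of [j], the index [cube_of m x] is constantly [j]. *)
    rewrite (eq_esum (b := fun x => (normc (h x) `^ s)%:E)); last first.
      by move=> x /= ->.
    apply: esum_powR_le_card => // x; exact: normc_ge0.
  have -> : (D * A * B * w) `^ s = (D * A * B) `^ s * w `^ s.
    by rewrite powRM// !mulr_ge0.
  rewrite -EFinD -EFinM lee_fin mulrA ler_wpM2l//.
  by apply: powR_mul_le_add; rewrite ?fine_inv_ge0// le1.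
rewrite ge0_esumZl//; last by move=> j; rewrite adde_ge0 ?lee_fin.
rewrite -/A -/B -/c [leRHS]EFinM lee_wpmul2l ?lee_fin//.
rewrite esumD; [|by move=> j _; rewrite lee_fin..].
rewrite -!shift; apply: le_trans (leeD W1 V1) _.
by rewrite -EFinD lee_fin.
Qed.

(** The [9 ^ d] pairs of offsets contribute equally.  After taking the [s]-th
    root, [N `^ ((1 - s) / s)] is the loss due to Hoelder's inequality. *)
Lemma lpnorm_avg_le (f g : 'rV[int]_d -> R[i]) : (l <= m ^ 2)%N ->
  (lpnorm p f < +oo)%E -> (lpnorm q g < +oo)%E ->
  (lpnorm s%:E (bisphere_avg l f g) <=
   (((9 ^ d)%:R * 2) `^ s^-1 * N `^ ((1 - s) / s) * D)%:E * lpnorm p f * lpnorm q g)%E.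
Proof.
move=> lm ffin gfin; have [s0 s1] := andP s01.
pose A := fine (lpnorm p f); pose B := fine (lpnorm q g).
have fE : lpnorm p f = A%:E by rewrite fineK// ge0_fin_numE ?lpnorm_ge0.
have gE : lpnorm q g = B%:E by rewrite fineK// ge0_fin_numE ?lpnorm_ge0.
have A0 : 0 <= A by rewrite fine_ge0// lpnorm_ge0.
have B0 : 0 <= B by rewrite fine_ge0// lpnorm_ge0.
have N0 : 0 <= N by apply: le_trans mN; rewrite ler0n.
pose c := N `^ (1 - s) * (D * A * B) `^ s * 2.
have c0 : 0 <= c by rewrite !mulr_ge0 ?powR_ge0.
have -> : ((((9 ^ d)%:R * 2) `^ s^-1 * N `^ ((1 - s) / s) * D)%:E *
    lpnorm p f * lpnorm q g)%E = (((9 ^ d)%:R * c)%:E `^ s^-1)%E.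
  rewrite fE gE -!EFinM poweR_EFin; congr EFin.
  have -> : (9 ^ d)%:R * c = (9 ^ d)%:R * 2 * N `^ (1 - s) * (D * A * B) `^ s.
    by rewrite /c; ring.
  rewrite [RHS]powRM ?mulr_ge0 ?powR_ge0 ?ler0n//.
  rewrite [X in _ = X * _]powRM ?mulr_ge0 ?powR_ge0 ?ler0n//.
  rewrite -!powRrM divff ?gt_eqF// powRr1 ?mulr_ge0//; ring.
apply: gt0_ler_poweR; rewrite ?invr_ge0 ?(ltW s0)//.
- by rewrite in_itv/= leey andbT; apply: esum_ge0 => x _; rewrite lee_fin powR_ge0.
- by rewrite in_itv/= leey andbT lee_fin mulr_ge0.
pose T e x := normc (bisphere_avg l
  (piece (cube_of m) f (cube_of m x + @cube_offset d e.1))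
  (piece (cube_of m) g (cube_of m x + @cube_offset d e.2)) x) `^ s.
apply: (@le_trans _ _ (\esum_(x in [set: 'rV[int]_d]) \sum_e (T e x)%:E)%E).
  apply: le_esum => x _; rewrite sumEFin lee_fin (bisphere_avg_pieces m0 _ _ _ lm).
  apply: le_trans (powR_sum_le _ _ s01 (fun e => normc_ge0 _)).
  by rewrite ge0_ler_powR ?nnegrE ?normc_ge0 ?(ltW s0)// ?sumr_ge0 ?normc_sum//
     => e _; rewrite normc_ge0.
rewrite esum_sum; last by move=> *; rewrite lee_fin powR_ge0.
apply: (@le_trans _ _ (\sum_(e : {ffun 'I_d -> 'I_3} * {ffun 'I_d -> 'I_3}) c%:E)%E).
  by apply: lee_sum => e _; exact: esum_avg_pieces.
rewrite sumEFin lee_fin sumr_const card_prod card_ffun !card_ord -expnMn.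
by rewrite mulr_natl.
Qed.
End pair.

Theorem lemma1 (R : realType) (d : nat) :
  exists K : R -> R -> R,
  forall (p q : \bar R) (r gamma C : R),
    (0 < p)%E -> (0 < q)%E ->
    (r^-1)%:E = (p^-1 + q^-1)%E -> 1 < r^-1 ->
    (forall l : nat, (0 < l)%N -> (0 < bisphere_card d l)%N ->
       forall f g : 'rV[int]_d -> R[i],
         (lpnorm p f < +oo)%E -> (lpnorm q g < +oo)%E ->
         (lpnorm 1%:E (bisphere_avg l f g) <=
            (C * l%:R `^ (- gamma))%:E * lpnorm p f * lpnorm q g)%E) ->
    forall s : R, r <= s <= 1 ->
    forall l : nat, (0 < l)%N -> (0 < bisphere_card d l)%N ->
      forall f g : 'rV[int]_d -> R[i],
        (lpnorm p f < +oo)%E -> (lpnorm q g < +oo)%E ->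
        (lpnorm s%:E (bisphere_avg l f g) <=
           (K s C * l%:R `^ (d%:R * (1 - s) / (2 * s) - gamma))%:E
             * lpnorm p f * lpnorm q g)%E.
Proof.
(* [9 ^ d] pairs of offsets, total weight 2, and [2 ^ d] because the cubes have
   up to [2 ^ d * l `^ (d / 2)] points.  The absolute value of [C] makes the
   constant of the l^1 estimate nonnegative. *)
exists (fun s C => ((9 ^ d)%:R * 2) `^ s^-1 * ((2 ^ d)%:R `^ ((1 - s) / s)) * `|C|).
move=> p q r gamma C p0 q0 rpq r1 l1_bound s /andP[rs s1] l l0 card0 f g ffin gfin.
have r0 : 0 < r by rewrite -invr_gt0 (lt_trans _ r1).
have s0 : 0 < s by exact: lt_le_trans rs.
have s01 : 0 < s <= 1 by rewrite s0.
have [m [m0 lm m2]] := @sqrt_side R l l0.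
have lR : 0 < l%:R :> R by rewrite ltr0n.
pose N : R := (2 ^ d)%:R * l%:R `^ (d%:R / 2).
have mN : (m ^ d)%:R <= N.
  rewrite /N natrX (natrX _ 2) mulrC powRrM powRAC powR_mulrn ?powR_ge0//.
  by rewrite powR12_sqrt ?ler0n// mulrC -exprMn lerXn2r ?nnegrE ?mulr_ge0 ?sqrtr_ge0.
have pqs : 1 <= (fine p^-1 + fine q^-1) * s.
  rewrite -fineD.
    by rewrite -rpq/= ler_pdivlMl// mulr1.
  by have := congr1 (fun x => x \is a fin_num) rpq; rewrite fin_numD => /esym /andP[].
  by have := congr1 (fun x => x \is a fin_num) rpq; rewrite fin_numD => /esym /andP[].
pose D := `|C| * l%:R `^ (- gamma).
have D0 : 0 <= D by rewrite mulr_ge0 ?powR_ge0.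
have l1D (f' g' : 'rV[int]_d -> R[i]) :
    (lpnorm p f' < +oo)%E -> (lpnorm q g' < +oo)%E ->
    (lpnorm 1%:E (bisphere_avg l f' g') <= D%:E * lpnorm p f' * lpnorm q g')%E.
  move=> f'fin g'fin; apply: le_trans (l1_bound l l0 card0 f' g' f'fin g'fin) _.
  rewrite !lee_wpmul2r ?lpnorm_ge0// lee_fin ler_wpM2r ?powR_ge0//.
  exact: ler_norm.
apply: le_trans (lpnorm_avg_le p0 q0 m0 D0 s01 mN pqs l1D lm ffin gfin) _.
rewrite le_eqVlt; apply/orP; left; apply/eqP.
congr (_%:E * _ * _)%E.
have -> : N `^ ((1 - s) / s) =
    (2 ^ d)%:R `^ ((1 - s) / s) * l%:R `^ (d%:R * (1 - s) / (2 * s)).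
  rewrite powRM ?powR_ge0// -powRrM; congr (_ * _ `^ _).
  by field; rewrite gt_eqF.
by rewrite /D powRD ?(gt_eqF lR) ?implybT//; ring.
Qed.
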